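(* Let $n\ge 2$ be an integer such that the solution $v_n>0$ of the equation (in $x$) $$\frac{16}{x}+\log\left(1+\frac{2}{x}+4\log\frac{4}{x}\right)=\log(2n)$$ is smaller than $1$. Let $X_{(1)}$ be the maximum of the absolute values of $n$ independent standard Gaussian random variables. Then for all $0\le\lambda<\frac{1}{\sqrt{v_n}}$, $$\log\mathbb{E}\left[e^{\lambda(X_{(1)}-\mathbb{E}X_{(1)})}\right]\le\frac{v_n\lambda^2}{2(1-\sqrt{v_n}\,\lambda)},$$ and for all $t>0$, $$\mathbb{P}\left\{X_{(1)}-\mathbb{E}X_{(1)}>\sqrt{v_n}\,(t+\sqrt{2t})\right\}\le e^{-t}.$$
   Context: $\log$ is the natural logarithm. *)

(* Defs.v *)
From HB Require Import structures.
From mathcomp Require Export all_boot all_order all_algebra.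
From mathcomp Require Export all_classical all_reals all_analysis.
Export Order.TTheory GRing.Theory Num.Theory.
Export numFieldNormedType.Exports.

Set Implicit Arguments.
Unset Strict Implicit.
Unset Printing Implicit Defensive.

Local Open Scope classical_set_scope.
Local Open Scope ring_scope.

(* [normal_prob 0 1] is a measure on Borel sets only, so the two laws are
   compared on measurable sets. *)
Definition standard_gaussian d (T : measurableType d) (R : realType)
    (P : probability T R) (X : {RV P >-> R}) : Prop :=
  forall A : set R, measurable A -> distribution P X A = normal_prob 0 1 A.

Definition mutually_independent d (T : measurableType d) (R : realType)
    (P : probability T R) (I : finType) (X : I -> {RV P >-> R}) : Prop :=
  forall (J : {set I}) (A : I -> set R), (forall i, measurable (A i)) ->
    P (\bigcap_(i in [set` J]) (X i @^-1` A i)) =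
    (\prod_(i in J) P (X i @^-1` A i))%E.

(* The neutral element 0 of the iterated maximum is harmless: every term is
   nonnegative, so this is the genuine maximum as soon as 0 < n. *)
Definition max_abs d (T : measurableType d) (R : realType)
    (n : nat) (X : 'I_n -> {mfun T >-> R}) (w : T) : R :=
  \big[Num.max/0]_(i < n) `|X i w|.

Arguments standard_gaussian {d T R} P X.
Arguments mutually_independent {d T R} P {I} X.

(* Main.v *)
Require Import Defs.
From mathcomp Require Import ring lra measurable_realfun.

(* Write M for the maximum and phi(x) = e^x - 1 - x. For every constant a,
   log E e^(l(M - EM)) <= E phi(l(M - a)), because log(1 + x) <= x absorbs the
   linear term. Take a^2 = 2L - log(2L) with L = log(2n), so that
   K = 2n gamma(a)/a, the approximate mean number of |X_i| exceeding a, is of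
   order 1.
   Above a, phi(l(M - a)) <= (2l/a)^2 (e^(a(M - a)/2) - 1), which is at most the
   sum of the same quantities for the |X_i|; their expectation is a Gaussian
   integral bounded by means of gamma(a + s) <= gamma(a) e^(-as).
   Below a, phi(l(M - a)) <= l^2 (a - M)^2 / 2, and (a - M)^2 is dominated by a
   step function with mesh 2/a. By independence P(M < x) <= e^(-n P(|X_1| > x)),
   and comparison with rectangles under the Gaussian density makes the
   probability of the j-th step at most (10/7)(2/5)^j.
   Altogether log E e^(l(M - EM)) <= (l/a)^2 (4K + 100/9) <= v l^2 / 2, using
   v >= 16/L. The tail bound is Chernoff's. *)

Set Implicit Arguments.
Unset Strict Implicit.
Unset Printing Implicit Defensive.

Local Open Scope classical_set_scope.
Local Open Scope ring_scope.

(** * Elementary inequalities for exponentials, logarithms and finite sums *)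

Lemma le_at0_of_derive_ge0 (R : realType) (f f' : R -> R) :
  (forall x : R, is_derive x 1 f (f' x)) -> (forall x, 0 <= x -> 0 <= f' x) ->
  forall x, 0 <= x -> f 0 <= f x.
Proof.
move=> df f'0 x x0; apply: (@ger0_derive1_ndecry _ f 0) => //.
- by move=> y; rewrite in_itv/= andbT => /ltW y0; rewrite derive1E derive_val f'0.
- apply: continuous_subspaceT => y.
  by apply: differentiable_continuous; exact/derivable1_diffP.
Qed.

Lemma expR_ge_quad (R : realType) (x : R) : 0 <= x -> 1 + x + x ^+ 2 / 2 <= expR x.
Proof.
move=> x0; rewrite -subr_ge0.
apply: le_trans (@le_at0_of_derive_ge0 _ (fun y => expR y - (1 + y + y ^+ 2 / 2))
  (fun y => expR y - (1 + y)) _ _ _ x0).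
- by rewrite expR0; lra.
- by move=> y; apply: is_derive_eq; rewrite /GRing.scale/=; lra.
- by move=> y _; rewrite subr_ge0 expR_ge1Dx.
Qed.

(** The previous bound at [-x] gives [e^x (1 - x + x^2/2) <= 1], and [(1 - x + x^2/2)(1 + x + x^2/2)
    = 1 + x^4/4 >= 1]. *)
Lemma expR_le_quad (R : realType) (x : R) : x <= 0 -> expR x <= 1 + x + x ^+ 2 / 2.
Proof.
move=> x0; have y0 : 0 <= - x by lra.
have := expR_ge_quad y0; have := expR_gt0 x; have := expRxMexpNx_1 x.
set E := expR x; set F := expR (- x) => EF E0 HF.
have : E * (1 - x + x ^+ 2 / 2) <= 1 by rewrite -[leRHS]EF ler_pM2l//; lra.
have x2 := sqr_ge0 x; have : 0 <= E * x ^+ 4 by rewrite mulr_ge0 ?exprn_even_ge0// ltW.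
have -> : E * x ^+ 4 = 4 * (E * ((1 + x ^+ 2 / 2) ^+ 2 - x ^+ 2) - E) by field.
set q := 1 + x + _ => *.
have q0 : 0 <= q by rewrite /q; have := sqr_ge0 (1 + x); lra.
suff : E <= (E * (1 - x + x ^+ 2 / 2)) * q by nra.
by rewrite /q; lra.
Qed.

(** With [phi(x) = e^x - 1 - x], this is [phi(r x) <= r^2 phi(x)] with the term [- r^2 x] dropped.
    Differentiating twice in [x] reduces it to [e^(r x) <= e^x]. *)
Lemma expR_scale_le (R : realType) (r x : R) : 0 <= r -> r <= 1 -> 0 <= x ->
  expR (r * x) <= 1 + r * x + r ^+ 2 * (expR x - 1).
Proof.
move=> r0 r1 x0.
have h y : 0 <= y -> 0 <= r * (expR y - 1) - (expR (r * y) - 1).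
  move=> y0; apply: le_trans (@le_at0_of_derive_ge0 _
    (fun y => r * (expR y - 1) - (expR (r * y) - 1))
    (fun y => r * (expR y - expR (r * y))) _ _ _ y0).
  - by rewrite mulr0 expR0; lra.
  - by move=> z; apply: is_derive_eq; rewrite /GRing.scale/=; lra.
  - by move=> z z0; rewrite mulr_ge0// subr_ge0 ler_expR ler_piMl.
suff : 0 <= r ^+ 2 * (expR x - 1 - x) - (expR (r * x) - 1 - r * x).
  by have := mulr_ge0 (sqr_ge0 r) x0; lra.
apply: le_trans (@le_at0_of_derive_ge0 _
    (fun x => r ^+ 2 * (expR x - 1 - x) - (expR (r * x) - 1 - r * x))
    (fun y => r * (r * (expR y - 1) - (expR (r * y) - 1))) _ _ _ x0).
- by rewrite mulr0 expR0; lra.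
- by move=> z; apply: is_derive_eq; rewrite /GRing.scale/=; ring.
- by move=> z z0; rewrite mulr_ge0// h.
Qed.

(** [35/9] is the sum of the infinite series; the induction carries the exact remainder. *)
Lemma sum_odd_geometric (R : realType) (J : nat) :
  \sum_(j < J) (2 * j%:R + 1) * (2 / 5) ^+ j <= 35 / 9 :> R.
Proof.
suff : \sum_(j < J) (2 * j%:R + 1) * (2 / 5) ^+ j =
    35 / 9 - (10 / 3 * J%:R + 35 / 9) * (2 / 5) ^+ J :> R.
  by move=> ->; rewrite lerBlDr lerDl mulr_ge0 ?exprn_ge0.
elim: J => [|J IH]; first by rewrite big_ord0 expr0; lra.
by rewrite big_ord_recr/= IH exprS -natr1; field.
Qed.

(** Consecutive odd numbers sum to squares: for [x] in []j e, (j + 1) e]] the active steps add up to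
    [((j + 1) e)^2]. *)
Lemma sqr_le_sum_steps (R : realType) (e x : R) (J : nat) : 0 <= e ->
  0 <= x -> x <= J%:R * e ->
  x ^+ 2 <= \sum_(j < J) (2 * j%:R + 1) * e ^+ 2 * (j%:R * e < x :> R)%R%:R.
Proof.
move=> e0 x0; elim: J => [|J IH] xJ; first by rewrite big_ord0; nra.
rewrite big_ord_recr/=; case: ltP => [xlt|/IH {}IH]; last by rewrite mulr0 addr0.
rewrite mulr1 (eq_bigr (fun j : 'I_J => (2 * j%:R + 1) * e ^+ 2)) => [|j _]; last first.
  by rewrite (le_lt_trans _ xlt) ?mulr1// ler_wpM2r// ler_nat ltnW.
have -> : \sum_(j < J) (2 * j%:R + 1) * e ^+ 2 = J%:R ^+ 2 * e ^+ 2 :> R.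
  elim: J {IH xJ xlt} => [|J IH]; first by rewrite big_ord0; lra.
  by rewrite big_ord_recr/= IH -natr1; ring.
move: xJ; rewrite -natr1 => xJ.
have -> : J%:R ^+ 2 * e ^+ 2 + (2 * J%:R + 1) * e ^+ 2 = ((J%:R + 1) * e) ^+ 2 by ring.
by rewrite lerXn2r ?nnegrE// mulr_ge0// addr_ge0.
Qed.

(** With [y = L/16 >= 1] the claim reads [32 y <= (e^y)^4]. It follows from [e^y >= 12/5 y], since
    [(12/5)^4 > 33] and [y <= y^4]. *)
Lemma ln_double_le (R : realType) (L : R) : 16 <= L -> ln (2 * L) <= L / 4.
Proof.
move=> L16; rewrite -ler_expR lnK ?posrE; last lra.
have L0 : 0 <= L / 16 by lra.
have -> : L / 4 = 4%:R * (L / 16) by field.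
have := expR_ge_quad L0; rewrite expRM_natl.
set y := L / 16 in L0 *; have -> : L = 16 * y by rewrite /y; field.
have y1 : 1 <= y by rewrite /y; lra.
(* The quadratic [1 + y + y^2/2 - 12/5 y] is minimal at [7/5], with value [1/50]. *)
have y2 := sqr_ge0 (y - 7 / 5) => h.
have h1 : 12 / 5 * y <= expR y by lra.
apply: le_trans (_ : (12 / 5 * y) ^+ 4 <= _).
  have : y <= y ^+ 4 by rewrite ler_eXnr.
  have -> : (12 / 5 * y) ^+ 4 = 20736 / 625 * y ^+ 4 by field.
  lra.
by rewrite lerXn2r ?nnegrE ?expR_ge0//; lra.
Qed.

(** * Integrals against the Gaussian density *)

(** The Radon-Nikodym derivative of the normal law agrees almost everywhere with the density, as
    both have the same integral over every measurable set. *)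
Lemma ge0_integral_normal_prob (R : realType) (m s : R) (f : R -> R) :
  (forall x, 0 <= f x) -> measurable_fun [set: R] f ->
  (\int[normal_prob m s]_x (f x)%:E =
   \int[lebesgue_measure]_x (f x * normal_pdf m s x)%:E)%E.
Proof.
move=> f0 mf; under [RHS]eq_integral do rewrite EFinM.
have mEf : measurable_fun [set: R] (EFin \o f) by exact/measurable_EFinP.
have dom := normal_prob_dominates m s.
have rnE := Radon_Nikodym_SigmaFinite.f_integral dom.
have rni := Radon_Nikodym_SigmaFinite.f_integrable dom.
rewrite -(Radon_Nikodym_SigmaFinite.change_of_variables dom)//.
have mpdf : measurable_fun [set: R] (fun x => (normal_pdf m s x)%:E).
  by apply/measurable_EFinP; exact: measurable_normal_pdf.
apply: ae_eq_integral => //.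
- by apply: emeasurable_funM => //; exact: measurable_int rni.
- exact: emeasurable_funM.
- apply: ae_eqe_mul2l; apply: integral_ae_eq => // E _ mE.
  by rewrite -rnE.
Qed.

Lemma normal_pdf01E (R : realType) (x y : R) :
  normal_pdf 0 1 x = normal_pdf 0 1 y * expR ((y ^+ 2 - x ^+ 2) / 2).
Proof.
rewrite normal_pdfE ?oner_eq0// -mulrA; congr (_ * _).
rewrite /normal_fun -expRD; congr expR.
by rewrite !subr0 expr1n; field.
Qed.

(** It vanishes on [[-a, a]] and is nonnegative for [b >= 0], which allows the maximum to be
    replaced by a sum over the variables. *)
Definition overshoot (R : realType) (b a x : R) : R :=
  expR (b * Num.max 0 (`|x| - a)) - 1.

Lemma overshoot_ge0 (R : realType) (b a x : R) : 0 <= b -> 0 <= overshoot b a x.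
Proof.
by move=> b0; rewrite subr_ge0 -expR0 ler_expR mulr_ge0// le_max lexx.
Qed.

Lemma continuous_overshoot (R : realType) (b a : R) :
  continuous (overshoot b a).
Proof.
move=> x; apply: cvgB; last exact: cvg_cst.
apply: continuous_comp; last exact: continuous_expR.
apply: cvgM; first exact: cvg_cst.
apply: (@continuous_max _ _ (cst 0) (fun x => `|x| - a)); first exact: cvg_cst.
apply: cvgB; last exact: cvg_cst.
exact: norm_continuous.
Qed.

Lemma cvg_expR_decay (R : realType) (c a : R) : 0 < c ->
  expR (- (c * (x - a))) @[x --> +oo] --> (0 : R).
Proof.
move=> c0; under eq_fun do rewrite mulrC.
apply: (@cvg_comp _ _ _ (fun x => (x - a) * c) (fun y => expR (- y))).
  by apply: gt0_cvgMly => //; exact: cvg_addrr.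
exact: cvgr_expR.
Qed.

(** The primitive [F] tends to [0] at infinity, and [- F a = k (2/a - 1/a)]. *)
Lemma integral_decay_diff (R : realType) (a k : R) : 0 < a -> 0 <= k ->
  (\int[lebesgue_measure]_(x in `[a, +oo[)
    (k * (expR (- (a / 2 * (x - a))) - expR (- (a * (x - a)))))%:E = (k / a)%:E)%E.
Proof.
move=> a0 k0.
pose F x := k * (a^-1 * expR (- (a * (x - a))) - 2 / a * expR (- (a / 2 * (x - a)))).
pose f x := k * (expR (- (a / 2 * (x - a))) - expR (- (a * (x - a)))).
have dF (x : R) : is_derive x 1 F (f x).
  by rewrite /F; apply: is_derive_eq; rewrite /GRing.scale/= /f; field; rewrite gt_eqF.
have dF1 x : derivable F x 1 by exact: ex_derive.
have cont (x : R) : {for x, continuous F}.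
  by apply: differentiable_continuous; exact/derivable1_diffP.
rewrite (@ge0_continuous_FTC2y _ f F a 0).
- by rewrite -EFinB sub0r /F subrr !mulr0 oppr0 expR0; congr EFin; field; rewrite gt_eqF.
- move=> x ax; rewrite mulr_ge0// subr_ge0 ler_expR lerN2 ler_wpM2r ?subr_ge0//.
  by lra.
- apply: continuous_subspaceT => x.
  apply: cvgM; first exact: cvg_cst.
  by apply: cvgB; apply: continuous_comp; try exact: continuous_expR;
    apply: cvgN; apply: cvgM; (try exact: cvg_cst); apply: cvgB;
    (try exact: cvg_cst); exact: cvg_id.
- rewrite -[X in _ --> X](_ : k * (a^-1 * 0 - 2 / a * 0) = 0); last by ring.
  apply: cvgM; first exact: cvg_cst.
  apply: cvgB; (apply: cvgM; first exact: cvg_cst); apply: cvg_expR_decay => //.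
  by lra.
- by move=> x _.
- exact/cvg_at_right_filter/cont.
- by move=> x _; rewrite derive1E derive_val.
Qed.

(** Symmetry reduces to [x >= 0]. For [x >= a] the density is at most [gamma(a) e^(-a(x - a))],
    because [(x - a)^2 >= 0]; multiplied by [e^(a(x - a)/2) - 1], this is the difference of
    exponentials integrated above. *)
Lemma integral_overshoot_le (R : realType) (a : R) : 0 < a ->
  (\int[lebesgue_measure]_x (overshoot (a / 2) a x * normal_pdf 0 1 x)%:E
   <= (2 * (normal_pdf 0 1 a / a))%:E)%E.
Proof.
move=> a0; have b0 : 0 <= a / 2 by lra.
pose f x := overshoot (a / 2) a x * normal_pdf 0 1 x.
have f0 x : 0 <= f x by rewrite mulr_ge0 ?overshoot_ge0 ?normal_pdf_ge0.
have cf : continuous f.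
  move=> x; apply: cvgM; first exact: continuous_overshoot.
  by apply: continuous_normal_pdf; rewrite oner_eq0.
rewrite (@ge0_symfun_integralT _ f)//; last first.
  move=> x; rewrite /f /overshoot /= normrN; congr (_ * _).
  by rewrite (normal_pdf01E (- x) x) sqrrN subrr mul0r expR0 mulr1.
rewrite EFinM lee_pmul2l// -integral_decay_diff ?normal_pdf_ge0//.
rewrite integral_mkcond [leRHS]integral_mkcond.
have mpos : measurable [set x : R | 0 <= x] by rewrite -set_itvcy.
have mf : measurable_fun [set: R] f by exact: continuous_measurable_fun.
apply: ge0_le_integral => //.
- by move=> x _; apply: erestrict_ge0 => y _; rewrite lee_fin.
- apply/(measurable_restrictT _ _).1 => //; apply/measurable_EFinP.
  exact: measurable_funTS.
- apply/(measurable_restrictT _ _).1 => //; apply/measurable_EFinP.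
  apply: measurable_funTS; apply: measurable_funM => //.
  by apply: measurable_funB; apply: measurableT_comp => //;
    apply: measurableT_comp => //; apply: measurable_funM => //; exact: measurable_funB.
move=> x _; rewrite !patchE; case: ifPn => [|_]; last first.
  case: ifPn => //; rewrite inE/= in_itv/= andbT => ax.
  rewrite lee_fin mulr_ge0 ?normal_pdf_ge0// subr_ge0 ler_expR lerN2 ler_wpM2r ?subr_ge0//.
  lra.
rewrite inE/= => x0; case: ifPn; last first.
  rewrite notin_setE/= in_itv/= andbT => /negP; rewrite -ltNge => xa.
  rewrite lee_fin /f /overshoot ger0_norm// max_l ?subr_le0 ?(ltW xa)//.
  by rewrite mulr0 expR0 subrr mul0r.
rewrite inE/= in_itv/= andbT => ax; rewrite lee_fin /f /overshoot ger0_norm// max_r ?subr_ge0//.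
rewrite (normal_pdf01E x a) mulrCA ler_wpM2l ?normal_pdf_ge0//.
have -> : - (a / 2 * (x - a)) = a / 2 * (x - a) - a * (x - a) by field.
rewrite expRD -[X in _ <= _ - X]mul1r -mulrBl ler_wpM2l//; last first.
  by rewrite ler_expR; have := sqr_ge0 (x - a); lra.
by rewrite subr_ge0 -[leLHS]expR0 ler_expR mulr_ge0// subr_ge0.
Qed.

Lemma ge0_integral_standard_gaussian d (T : measurableType d) (R : realType)
    (P : probability T R) (X : {RV P >-> R}) (f : R -> R) :
  standard_gaussian P X -> (forall x, 0 <= f x) -> measurable_fun [set: R] f ->
  (\int[P]_w (f (X w))%:E =
   \int[lebesgue_measure]_x (f x * normal_pdf 0 1 x)%:E)%E.
Proof.
move=> hX f0 mf; rewrite -ge0_integral_normal_prob//.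
have mEf : measurable_fun [set: R] (EFin \o f) by exact/measurable_EFinP.
rewrite -(ge0_integral_distribution X mEf)//.
(* [R] and [measurableTypeR R] carry the same sigma-algebra but distinct
   structures, hence the detour through the identity random variable. *)
pose N : probability _ R := normal_prob (0 : R) 1.
have mid : measurable_fun [set: measurableTypeR R] (id : measurableTypeR R -> R).
  by move=> _ A mA; rewrite setTI.
pose idR : {RV N >-> R} :=
  @mfun_Sub _ _ _ R (id : measurableTypeR R -> R) (mem_set mid).
rewrite (@eq_measure_integral _ _ _ _ (distribution N idR))//; last first.
  by move=> A mA _; exact: hX.
by rewrite ge0_integral_distribution.
Qed.

Lemma expectation_overshoot_le d (T : measurableType d) (R : realType)
    (P : probability T R) (X : {RV P >-> R}) (a : R) :
  standard_gaussian P X -> 0 < a ->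
  (\int[P]_w (overshoot (a / 2) a (X w))%:E <= (2 * (normal_pdf 0 1 a / a))%:E)%E.
Proof.
move=> hX a0; have b0 : 0 <= a / 2 by lra.
rewrite (ge0_integral_standard_gaussian hX); first exact: integral_overshoot_le.
- by move=> x; exact: overshoot_ge0.
- by apply: continuous_measurable_fun; exact: continuous_overshoot.
Qed.

(** * Small values of the maximum *)

Lemma normal_prob_ge_itv (R : realType) (c l r : R) (A : set R) : l <= r ->
  measurable A -> `]l, r[ `<=` A -> (forall x, l < x < r -> c <= normal_pdf 0 1 x) ->
  0 <= c -> ((c * (r - l))%:E <= normal_prob 0 1 A)%E.
Proof.
move=> lr mA sA hc c0.
have -> : (c * (r - l))%:E = (\int[lebesgue_measure]_(x in `]l, r[) c%:E)%E.
  rewrite integral_cst//= lebesgue_measure_itv/= lte_fin; case: ltP => // rl.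
  by rewrite (_ : r = l) ?subrr ?mulr0 ?mule0//; lra.
have mpdf : measurable_fun [set: R] (fun x : R => (normal_pdf 0 1 x)%:E).
  by apply/measurable_EFinP; exact: measurable_normal_pdf.
apply: (@le_trans _ _ (\int[lebesgue_measure]_(x in `]l, r[) (normal_pdf 0 1 x)%:E)%E).
  by apply: ge0_le_integral => //; exact: measurable_funTS.
apply: ge0_subset_integral => //.
- exact: measurable_funTS.
- by move=> x _; rewrite lee_fin normal_pdf_ge0.
Qed.

(** The two intervals of length [e] adjoining [[-x, x]] are disjoint from it, and the density on
    them is at least its value at [x + e]; their mass is missing from the central interval. *)
Lemma standard_gaussian_central_le d (T : measurableType d) (R : realType)
    (P : probability T R) (X : {RV P >-> R}) (x e : R) :
  standard_gaussian P X -> 0 <= x -> 0 <= e ->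
  (P (X @^-1` `[(- x)%R, x]) <= (1 - 2 * e * normal_pdf 0 1 (x + e))%:E)%E.
Proof.
move=> hX x0 e0; pose A : set R := `[- x, x]%classic.
pose B : set R := `]x, x + e[%classic; pose C : set R := `](- (x + e)), (- x)[%classic.
have mA : measurable A by exact: measurable_itv.
have mB : measurable B by exact: measurable_itv.
have mC : measurable C by exact: measurable_itv.
have pdf_ge y : - (x + e) <= y <= x + e -> normal_pdf 0 1 (x + e) <= normal_pdf 0 1 y.
  move=> /andP[y1 y2]; rewrite (normal_pdf01E y (x + e)) ler_peMr ?normal_pdf_ge0//.
  by rewrite -[leLHS]expR0 ler_expR; nra.
rewrite [leLHS](hX _ mA) EFinB leeBrDr// -(@probability_setT _ _ _ (normal_prob 0 1)).
apply: (@le_trans _ _ (normal_prob 0 1 A + (normal_prob 0 1 B + normal_prob 0 1 C))%E).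
  apply: leeD2l.
  have -> : 2 * e * normal_pdf 0 1 (x + e) =
    normal_pdf 0 1 (x + e) * ((x + e) - x) + normal_pdf 0 1 (x + e) * (- x - - (x + e)).
    by ring.
  rewrite EFinD; apply: leeD; apply: normal_prob_ge_itv => //; rewrite ?normal_pdf_ge0//; try lra;
    by move=> y /andP[y1 y2]; apply: pdf_ge; apply/andP; split; lra.
rewrite -!measureU//; first apply: le_measure; rewrite ?inE//.
- by do 2?apply: measurableU.
- exact: measurableU.
- rewrite -subset0 /A /B /C => y [] /=; rewrite in_itv/= => /andP[y1 y2].
  by case=> /=; rewrite in_itv/= => /andP[y3 y4]; lra.
- rewrite -subset0 /B /C => y [] /=; rewrite in_itv/= => /andP[y1 y2].
  by rewrite in_itv/= => /andP[y3 y4]; lra.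
Qed.

Lemma measurable_max_abs d (T : measurableType d) (R : realType) (n : nat)
  (X : 'I_n -> {mfun T >-> R}) : measurable_fun [set: T] (max_abs X).
Proof.
rewrite /max_abs; elim: (index_enum _) => [|i s IH].
  by under eq_fun do rewrite big_nil; exact: measurable_cst.
under eq_fun do rewrite big_cons.
by apply: measurable_maxr => //; apply: measurableT_comp.
Qed.

Lemma measurable_max_abs_lt d (T : measurableType d) (R : realType) (n : nat)
  (X : 'I_n -> {mfun T >-> R}) (x : R) : measurable [set w | max_abs X w < x].
Proof.
rewrite -[X in measurable X]setTI.
have := measurable_max_abs X => /(_ measurableT `]-oo, x[%classic (measurable_itv _)).
by rewrite set_itvNyo.
Qed.

(** The event forces every [X i] into [[-x, x]]; by independence a product appears, with factors at
    most [1 - q <= e^(-q)]. *)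
Lemma max_abs_small_prob d (T : measurableType d) (R : realType)
    (P : probability T R) (n : nat) (X : 'I_n -> {RV P >-> R}) (x e : R) :
  (forall i, standard_gaussian P (X i)) -> mutually_independent P X ->
  0 <= x -> 0 <= e ->
  (P [set w | max_abs X w < x]%R <=
    (expR (- (n%:R * (2 * e * normal_pdf 0 1 (x + e)))))%:E)%E.
Proof.
move=> hX hind x0 e0; set q := 2 * e * _.
have mx : measurable (`[- x, x]%classic : set R) by exact: measurable_itv.
have mI i : measurable (X i @^-1` `[- x, x]).
  by rewrite -[X in measurable X]setTI; exact: measurable_funPT.
apply: (@le_trans _ _ (P (\bigcap_(i in [set` [set: 'I_n]%SET]) (X i @^-1` `[- x, x])))).
  apply: le_measure; rewrite ?inE.
  - exact: measurable_max_abs_lt.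
  - by apply: fin_bigcap_measurable => //; exact: finite_finset.
  - move=> w /= hw i _ /=; rewrite in_itv/= -ler_norml.
    by apply/ltW/(le_lt_trans _ hw); exact: le_bigmax.
rewrite (hind _ (fun=> `[- x, x]%classic))//.
rewrite (eq_bigr (fun i => (fine (P (X i @^-1` `[- x, x])))%:E)); last first.
  by move=> i _; rewrite fineK// fin_num_measure.
rewrite prodEFin lee_fin.
apply: (@le_trans _ _ (\prod_(i in [set: 'I_n]%SET) expR (- q))).
  apply: ler_prod => i _; rewrite fine_ge0//=.
  rewrite -lee_fin fineK ?fin_num_measure//.
  apply: le_trans (standard_gaussian_central_le (hX i) x0 e0) _.
  by rewrite lee_fin -/q; exact: expR_ge1Dx.
by rewrite prodr_const cardsT card_ord -expRM_natl mulrN.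
Qed.

(** * From a pointwise bound to the centred exponential moment *)

(** The overshoot of the larger of two values is one of the two overshoots, and the other is
    nonnegative; the neutral element [0] contributes nothing since [a >= 0]. *)
Lemma overshoot_bigmax (R : realType) (n : nat) (b a : R) (x : 'I_n -> R) :
  0 <= b -> 0 <= a ->
  overshoot b a (\big[Num.max/0]_(i < n) `|x i|) <= \sum_(i < n) overshoot b a (x i).
Proof.
move=> b0 a0; apply: (big_ind2 (fun u s : R => overshoot b a u <= s)).
- by rewrite /overshoot normr0 sub0r max_l ?oppr_le0// mulr0 expR0 subrr.
- move=> u s u' s' us us'.
  have := overshoot_ge0 a u b0; have := overshoot_ge0 a u' b0.
  by case: (leP u u') => _; lra.
- by move=> i _; rewrite /overshoot normr_id.
Qed.

(* Above [a] the second-order remainder of the exponential is controlled by the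
   sum of the overshoots, below [a] by a step function of [a - M]. *)
Lemma expR_max_le (R : realType) (n J : nat) (a l e : R) (x : 'I_n -> R)
    (M := \big[Num.max/0]_(i < n) `|x i|) :
  0 < a -> 0 <= l -> l <= a / 2 -> 0 <= e -> a <= J%:R * e ->
  expR (l * (M - a)) <= 1 + l * (M - a) +
    ((l / (a / 2)) ^+ 2 * \sum_(i < n) overshoot (a / 2) a (x i) +
     l ^+ 2 / 2 * \sum_(j < J) (2 * j%:R + 1) * e ^+ 2 * (M < a - j%:R * e)%R%:R).
Proof.
move=> a0 l0 la e0 aJ; have b0 : 0 <= a / 2 by lra.
have M0 : 0 <= M by exact: bigmax_ge_id.
have hM := overshoot_bigmax x b0 (ltW a0).
have hU : 0 <= \sum_(i < n) overshoot (a / 2) a (x i).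
  by apply: sumr_ge0 => i _; exact: overshoot_ge0.
have hS : 0 <= \sum_(j < J) (2 * j%:R + 1) * e ^+ 2 * (M < a - j%:R * e)%R%:R :> R.
  by apply: sumr_ge0 => j _; rewrite !mulr_ge0// ?addr_ge0// ?mulr_ge0// sqr_ge0.
case: (leP a M) => [aM|Ma].
  (* Here [l(M - a)] is [r = l/(a/2) <= 1] times [a(M - a)/2], so the rate [l] is traded for [a/2]
     at the price of [r^2]. *)
  have r0 : 0 <= l / (a / 2) by rewrite divr_ge0.
  have r1 : l / (a / 2) <= 1 by rewrite ler_pdivrMr; lra.
  have x0 : 0 <= a / 2 * (M - a) by rewrite mulr_ge0// subr_ge0.
  have := expR_scale_le r0 r1 x0.
  have -> : l / (a / 2) * (a / 2 * (M - a)) = l * (M - a) by field; rewrite gt_eqF.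
  have : expR (a / 2 * (M - a)) - 1 <= \sum_(i < n) overshoot (a / 2) a (x i).
    by apply: le_trans hM; rewrite /overshoot ger0_norm// max_r// subr_ge0.
  move=> /(ler_wpM2l (sqr_ge0 (l / (a / 2)))).
  have := mulr_ge0 (mulr_ge0 (sqr_ge0 l) (ler0n R 1)) hS; lra.
have h1 : l * (M - a) <= 0 by nra.
have aM0 : 0 <= a - M by lra.
have aMJ : a - M <= J%:R * e by lra.
have := sqr_le_sum_steps e0 aM0 aMJ.
under eq_bigr do rewrite ltrBrDl -ltrBrDr.
move=> /(ler_wpM2l (sqr_ge0 l)).
have := expR_le_quad h1; have := mulr_ge0 (sqr_ge0 (l / (a / 2))) hU; lra.
Qed.

Lemma integrable_ge0_le d (T : measurableType d) (R : realType)
    (P : {measure set T -> \bar R}) (G : T -> R) (g : R) :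
  measurable_fun [set: T] G -> (forall w, 0 <= G w) ->
  (\int[P]_w (G w)%:E <= g%:E)%E -> P.-integrable [set: T] (EFin \o G).
Proof.
move=> mG G0 Gg; apply/integrableP; split; first exact/measurable_EFinP.
under eq_integral do rewrite /= ger0_norm//.
exact: le_lt_trans Gg (ltry _).
Qed.

(* [E e^(l(M - EM)) = e^(l(a - EM)) E e^(l(M - a))], and the linear term
   [l(EM - a)] is absorbed by [1 + x <= e^x]. *)
Lemma expectation_expR_centered_le d (T : measurableType d) (R : realType)
    (P : probability T R) (M G : T -> R) (a l g : R) :
  P.-integrable [set: T] (EFin \o M) ->
  measurable_fun [set: T] G -> (forall w, 0 <= G w) ->
  (\int[P]_w (G w)%:E <= g%:E)%E ->
  (forall w, expR (l * (M w - a)) <= 1 + l * (M w - a) + G w) ->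
  ('E_P[fun w => expR (l * (M w - fine 'E_P[M]))] <= (expR g)%:E)%E.
Proof.
move=> iM mG G0 Gg hle.
have mM : measurable_fun [set: T] M by exact/measurable_EFinP/(measurable_int P).
have iG := integrable_ge0_le mG G0 Gg.
set m := fine _.
have EM : (\int[P]_w (M w)%:E)%E = m%:E.
  by rewrite /m unlock fineK// integrable_fin_num.
pose k := expR (l * (a - m)); pose c := k * (1 - l * a).
pose gG := fine (\int[P]_w (G w)%:E)%E.
have EG : (\int[P]_w (G w)%:E)%E = gG%:E by rewrite /gG fineK// integrable_fin_num.
have icst : P.-integrable [set: T] (EFin \o cst c).
  exact: finite_measure_integrable_cst.
have iklM : P.-integrable [set: T] (EFin \o (fun w => k * l * M w)).
  exact: (integrableZl _ (k * l) iM).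
have ikG : P.-integrable [set: T] (EFin \o (fun w => k * G w)).
  exact: (integrableZl _ k iG).
pose H w := (cst c w + k * l * M w) + k * G w.
have hH w : expR (l * (M w - m)) <= H w.
  have -> : l * (M w - m) = l * (a - m) + l * (M w - a) by ring.
  have -> : H w = k * (1 + l * (M w - a) + G w) by rewrite /H /cst /c; ring.
  by rewrite expRD ler_wpM2l ?expR_ge0.
have EH : (\int[P]_w (H w)%:E)%E = (k * (1 + l * (m - a) + gG))%:E.
  rewrite (@integralD_EFin _ _ _ P _ _ (fun w => cst c w + k * l * M w)
    (fun w => k * G w))//; last exact: (integrableD measurableT icst iklM).
  rewrite (@integralD_EFin _ _ _ P _ _ (cst c) (fun w => k * l * M w))//.
  have -> : (\int[P]_x (EFin \o cst c) x = c%:E)%E.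
    by rewrite (integral_cst P measurableT c%:E) [X in (_ * X)%E]probability_setT mule1.
  rewrite /=.
  have -> : (\int[P]_x (k * l * M x)%:E = (k * l * m)%:E)%E.
    under eq_integral do rewrite EFinM.
    by rewrite integralZl// EM.
  have -> : (\int[P]_x (k * G x)%:E = (k * gG)%:E)%E.
    under eq_integral do rewrite EFinM.
    by rewrite integralZl// EG.
  by rewrite -!EFinD; congr EFin; rewrite /c; ring.
apply: (@le_trans _ _ (\int[P]_w (H w)%:E)%E).
  rewrite unlock; apply: ge0_le_integral => //.
  - apply/measurable_EFinP; apply: measurableT_comp => //.
    by apply: measurable_funM => //; exact: measurable_funB.
  - apply/measurable_EFinP; apply: measurable_funD; first apply: measurable_funD => //;
      exact: measurable_funM.
  - by move=> w _; rewrite lee_fin.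
rewrite EH lee_fin.
have gGg : gG <= g by rewrite -lee_fin -EG.
have -> : g = l * (a - m) + (l * (m - a) + g) by ring.
rewrite expRD ler_wpM2l ?expR_ge0//.
by apply: le_trans (expR_ge1Dx _); lra.
Qed.

(** * Estimates at the threshold [a] with mesh [2/a] *)

Lemma expRN_le_inv (R : realType) (y : R) : 0 < y -> expR (- y) <= expR (- 1) / y.
Proof.
move=> y0; rewrite ler_pdivlMr// -ler_pdivlMl ?expR_gt0// -expRN opprK -expRD.
by have := expR_ge1Dx (y - 1); rewrite addrC; lra.
Qed.

Lemma expRN_nat_le (R : realType) (j : nat) : expR (- j%:R) <= (2 / 5) ^+ j :> R.
Proof.
rewrite -[j%:R]mulr1 -mulrN expRM_natl lerXn2r ?nnegrE ?expR_ge0//.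
have := expR_ge_quad (ler01 : 0 <= (1 : R)).
rewrite expRN => h; rewrite invf_ple ?posrE ?expR_gt0//; lra.
Qed.

(* By Mills' ratio, an approximation of the expected number of indices with
   [`|X i| > a]. *)
Definition exceedance (R : realType) (n : nat) (a : R) : R :=
  n%:R * (2 * (normal_pdf 0 1 a / a)).

(** At [j = 0] the bound exceeds 1. For [j = i + 1] and [e = 2/a], the small-value estimate at
    [x = a - j e] has exponent [y = 2K e^(2i - (i e)^2/2)]. As [i e <= a], [(i e)^2 <= 2i], hence
    [y >= 7/10 e^i], and [e^(-y) <= e^(-1)/y] gives geometric decay. *)
Lemma max_abs_lt_prob d (T : measurableType d) (R : realType)
    (P : probability T R) (n : nat) (X : 'I_n -> {RV P >-> R}) (a : R) (j : nat) :
  (forall i, standard_gaussian P (X i)) -> mutually_independent P X ->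
  0 < a -> 7 / 10 <= 2 * exceedance n a ->
  j%:R * (2 / a) <= a ->
  (P [set w | max_abs X w < a - j%:R * (2 / a)]%R <= (10 / 7 * (2 / 5) ^+ j)%:E)%E.
Proof.
move=> hX hind a0 K1; have e0 : 0 <= 2 / a by rewrite divr_ge0// ltW.
case: j => [_|i hi].
  by apply: (@le_trans _ _ 1%E); [exact/probability_le1/measurable_max_abs_lt|rewrite expr0 lee_fin; lra].
have x0 : 0 <= a - i.+1%:R * (2 / a) by rewrite subr_ge0.
apply: le_trans (max_abs_small_prob hX hind x0 e0) _; rewrite lee_fin.
set y := n%:R * _.
have ie : 0 <= i%:R * (2 / a) <= a.
  rewrite mulr_ge0//=; apply: le_trans hi.
  by rewrite ler_wpM2r// ler_nat.
have yE : y = 2 * exceedance n a * expR (i%:R * 2 - (i%:R * (2 / a)) ^+ 2 / 2).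
  rewrite /y -addrA (normal_pdf01E _ a) /exceedance.
  have -> : (a ^+ 2 - (a + (- (i.+1%:R * (2 / a)) + 2 / a)) ^+ 2) / 2 =
      i%:R * 2 - (i%:R * (2 / a)) ^+ 2 / 2.
    by rewrite -[i.+1%:R]natr1; field; rewrite gt_eqF.
  by field; rewrite gt_eqF.
have hz : 7 / 10 * expR i%:R <= y.
  rewrite yE ler_pM ?expR_ge0//.
  rewrite ler_expR.
  have : (i%:R * (2 / a)) ^+ 2 <= i%:R * 2.
    have -> : i%:R * 2 = a * (i%:R * (2 / a)) :> R by field; rewrite gt_eqF.
    by case/andP: ie => ? ?; rewrite expr2 ler_wpM2r.
  lra.
have z0 : 0 < 7 / 10 * expR i%:R :> R by rewrite mulr_gt0 ?expR_gt0//; lra.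
apply: (@le_trans _ _ (expR (- (7 / 10 * expR i%:R)))); first by rewrite ler_expR lerN2.
apply: le_trans (expRN_le_inv z0) _.
have -> : expR (- 1) / (7 / 10 * expR i%:R) = 10 / 7 * expR (- i.+1%:R) :> R.
  by rewrite -[i.+1%:R]natr1 opprD addrC expRD (expRN i%:R); field; rewrite gt_eqF ?expR_gt0.
by rewrite ler_wpM2l ?expRN_nat_le.
Qed.

Lemma integral_sum_overshoot_le d (T : measurableType d) (R : realType)
    (P : probability T R) (n : nat) (X : 'I_n -> {RV P >-> R}) (a : R) :
  (forall i, standard_gaussian P (X i)) -> 0 < a ->
  (\int[P]_w (\sum_(i < n) overshoot (a / 2) a (X i w))%:E <= (exceedance n a)%:E)%E.
Proof.
move=> hX a0; have b0 : 0 <= a / 2 by lra.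
have mo : measurable_fun [set: R] (overshoot (a / 2) a).
  by apply: continuous_measurable_fun; exact: continuous_overshoot.
under eq_integral do rewrite -sumEFin.
rewrite ge0_integral_sum//.
- apply: (@le_trans _ _ (\sum_(i < n) (2 * (normal_pdf 0 1 a / a))%:E)%E).
    by apply: lee_sum => i _; exact: expectation_overshoot_le.
  by rewrite sumEFin lee_fin sumr_const card_ord -[_ *+ n]mulr_natl.
- by move=> i; apply/measurable_EFinP; exact: measurableT_comp.
- by move=> i w _; rewrite lee_fin overshoot_ge0.
Qed.

(** The overshoot bound at threshold [1] suffices: [1 + y <= e^y] gives [M <= 1 + 2 U]. *)
Lemma integrable_max_abs d (T : measurableType d) (R : realType)
    (P : probability T R) (n : nat) (X : 'I_n -> {RV P >-> R}) :
  (forall i, standard_gaussian P (X i)) -> P.-integrable [set: T] (EFin \o max_abs X).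
Proof.
move=> hX; pose U w := \sum_(i < n) overshoot (1 / 2) 1 (X i w).
have U0 w : 0 <= U w by apply: sumr_ge0 => i _; apply: overshoot_ge0; lra.
have mU : measurable_fun [set: T] U.
  apply: measurable_sum => i; apply: measurableT_comp => //.
  by apply: continuous_measurable_fun; exact: continuous_overshoot.
have iU := integrable_ge0_le mU U0 (integral_sum_overshoot_le hX ltr01).
apply: (@le_integrable _ _ _ _ _ _ _ (EFin \o (fun w => 1 + 2 * U w))) => //.
- exact/measurable_EFinP/measurable_max_abs.
- move=> w _ /=; rewrite lee_fin !ger0_norm; last 2 first.
  + by rewrite addr_ge0// mulr_ge0.
  + exact: bigmax_ge_id.
  have := @overshoot_bigmax R n (1 / 2) 1 (fun i => X i w).
  rewrite -/(max_abs X w) -/(U w) /overshoot => h.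
  have := expR_ge1Dx (1 / 2 * Num.max 0 (`|max_abs X w| - 1)).
  have M0 : 0 <= max_abs X w by exact: bigmax_ge_id.
  have : max_abs X w - 1 <= Num.max 0 (`|max_abs X w| - 1).
    by rewrite ger0_norm// le_max lexx orbT.
  have := h _ ler01; lra.
- have i1 := finite_measure_integrable_cst P 1 measurableT.
  exact: (integrableD measurableT i1 (integrableZl measurableT 2 iU)).
Qed.

Lemma max_abs_mgf_le d (T : measurableType d) (R : realType)
    (P : probability T R) (n : nat) (X : 'I_n -> {RV P >-> R}) (a l : R) :
  (forall i, standard_gaussian P (X i)) -> mutually_independent P X ->
  0 < a -> 7 / 10 <= 2 * exceedance n a -> 0 <= l -> l <= a / 2 ->
  ('E_P[fun w => expR (l * (max_abs X w - fine 'E_P[max_abs X]))] <=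
   (expR ((l / a) ^+ 2 * (4 * exceedance n a + 100 / 9)))%:E)%E.
Proof.
move=> hX hind a0 K1 l0 la; have b0 : 0 <= a / 2 by lra.
pose e := 2 / a; have e0 : 0 <= e by rewrite divr_ge0// ltW.
(* With one step more than the integer part of [a/e], the steps cover [[0, a]], while each level
   [a - j e] with [j < J] stays nonnegative, as the small-value estimate requires. *)
pose J := (Num.trunc (a / e)).+1.
have e1 : 0 < e by rewrite divr_gt0.
have /andP[J1 J2] : (Num.trunc (a / e))%:R <= a / e < J%:R.
  by apply: truncn_itv; rewrite divr_ge0// ltW.
have aJ : a <= J%:R * e by rewrite -ler_pdivrMr// ltW.
have Jj (j : 'I_J) : j%:R * e <= a.
  by rewrite -ler_pdivlMr//; apply: le_trans J1; rewrite ler_nat -ltnS.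
pose U w := \sum_(i < n) overshoot (a / 2) a (X i w).
pose A j := [set w | max_abs X w < a - j%:R * e].
have mA j : measurable (A j) by exact: measurable_max_abs_lt.
pose S w := \sum_(j < J) (2 * j%:R + 1) * e ^+ 2 * \1_(A j) w.
pose G w := (l / (a / 2)) ^+ 2 * U w + l ^+ 2 / 2 * S w.
have c0 j : 0 <= (2 * j%:R + 1) * e ^+ 2 by rewrite mulr_ge0 ?sqr_ge0// addr_ge0// mulr_ge0.
have U0 w : 0 <= U w by apply: sumr_ge0 => i _; exact: overshoot_ge0.
have S0 w : 0 <= S w by apply: sumr_ge0 => j _; rewrite mulr_ge0.
have mU : measurable_fun [set: T] U.
  apply: measurable_sum => i; apply: measurableT_comp => //.
  by apply: continuous_measurable_fun; exact: continuous_overshoot.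
have mS : measurable_fun [set: T] S.
  by apply: measurable_sum => j; apply: measurable_funM => //; exact: measurable_indic.
have l20 : 0 <= l ^+ 2 / 2 by rewrite divr_ge0// sqr_ge0.
(* The mesh contributes [e^2 = 4/a^2], and [4 * 10/7 * 35/9 = 200/9]. *)
have iS : (\int[P]_w (S w)%:E <= (200 / 9 / a ^+ 2)%:E)%E.
  under eq_integral do rewrite -sumEFin.
  rewrite ge0_integral_sum//; last 2 first.
  - by move=> j; apply/measurable_EFinP; apply: measurable_funM => //; exact: measurable_indic.
  - by move=> j w _; rewrite lee_fin mulr_ge0.
  apply: (@le_trans _ _ (\sum_(j < J) ((2 * j%:R + 1) * e ^+ 2 * (10 / 7 * (2 / 5) ^+ j))%:E)%E).
    apply: lee_sum => j _; under eq_integral do rewrite EFinM.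
    rewrite ge0_integralZl//; last by rewrite lee_fin.
    rewrite integral_indic// setIT [leRHS]EFinM lee_wpmul2l ?lee_fin//.
      exact: max_abs_lt_prob.
    by apply/measurable_EFinP; exact: measurable_indic.
  rewrite sumEFin lee_fin.
  rewrite (eq_bigr (fun j : 'I_J => (e ^+ 2 * (10 / 7)) * ((2 * j%:R + 1) * (2 / 5) ^+ j)));
    last by move=> j _; ring.
  rewrite -mulr_sumr; apply: le_trans (ler_wpM2l _ (sum_odd_geometric R J)) _.
    by rewrite mulr_ge0// sqr_ge0.
  by rewrite le_eqVlt; apply/orP; left; apply/eqP; rewrite /e; field; rewrite gt_eqF.
apply: (@expectation_expR_centered_le _ _ _ _ _ G a).
- exact: integrable_max_abs.
- by apply: measurable_funD; exact: measurable_funM.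
- by move=> w; rewrite addr_ge0// mulr_ge0// sqr_ge0.
- under eq_integral do rewrite EFinD.
  rewrite ge0_integralD//; last 4 first.
  + by move=> w _; rewrite lee_fin mulr_ge0// sqr_ge0.
  + by apply/measurable_EFinP; exact: measurable_funM.
  + by move=> w _; rewrite lee_fin mulr_ge0.
  + by apply/measurable_EFinP; exact: measurable_funM.
  under eq_integral do rewrite EFinM.
  under [X in (_ + X)%E]eq_integral do rewrite EFinM.
  rewrite !ge0_integralZl//; try exact/measurable_EFinP;
    try (by move=> w _; rewrite lee_fin); rewrite ?lee_fin ?sqr_ge0//.
  have -> : (l / a) ^+ 2 * (4 * exceedance n a + 100 / 9) =
      (l / (a / 2)) ^+ 2 * exceedance n a + l ^+ 2 / 2 * (200 / 9 / a ^+ 2).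
    by field; rewrite gt_eqF.
  rewrite EFinD; apply: leeD; rewrite [leRHS]EFinM lee_wpmul2l ?lee_fin ?sqr_ge0//.
  exact: integral_sum_overshoot_le.
- move=> w; have := expR_max_le (fun i => X i w) a0 l0 la e0 aJ.
  rewrite -/(max_abs X w) => /le_trans; apply.
  rewrite lerD2l lerD2l ler_wpM2l//.
  rewrite le_eqVlt; apply/orP; left; apply/eqP; apply: eq_bigr => j _; congr (_ * _).
  by rewrite indicE; congr (nat_of_bool _)%:R; apply/idP/idP; rewrite inE.
Qed.

(** * Choice of the threshold *)

(* With [L = ln (2n)] and [a^2 = 2L - ln (2L)] the quantity [K] satisfies
   [K^2 pi a^2 = L] exactly, hence is bounded above and below. *)
Lemma exists_threshold (R : realType) (n : nat) (v : R) : (2 <= n)%N ->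
  0 < v -> 16 / v + ln (1 + 2 / v + 4 * ln (4 / v)) = ln (2 * n%:R) -> v < 1 ->
  exists a : R, let K := exceedance n a in
    [/\ 0 < a, 7 / 10 <= 2 * K, 4 <= a ^+ 2 * v &
        2 * (4 * K + 100 / 9) <= a ^+ 2 * v].
Proof.
move=> hn v0 hv v1; set L := ln (2 * n%:R) in hv.
have iv1 : 1 < v^-1 by rewrite -invr1 ltf_pV2 ?posrE.
(* Since [v < 1], the argument of the logarithm is at least [1], so the logarithm is nonnegative. *)
have hL : 16 / v <= L.
  rewrite -hv lerDl ln_ge0// -addrA lerDl addr_ge0//; first by lra.
  by rewrite mulr_ge0// ln_ge0//; lra.
have L16 : 16 <= L by apply: le_trans hL; lra.
have Lv : 16 <= L * v by rewrite -ler_pdivrMr.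
have lnL := ln_double_le L16.
have lnL0 : 0 <= ln (2 * L) by apply: ln_ge0; lra.
pose A := 2 * L - ln (2 * L).
have A1 : 7 / 4 * L <= A by rewrite /A; lra.
have A2 : A <= 2 * L by rewrite /A; lra.
have A0 : 0 < A by lra.
have a0 : 0 < Num.sqrt A by rewrite sqrtr_gt0.
have aE : Num.sqrt A ^+ 2 = A by rewrite sqr_sqrtr// ltW.
exists (Num.sqrt A); set a := Num.sqrt A in a0 aE *.
move=> K.
(* This is [7/4 * 16]. The last requirement is [8K + 200/9 <= A v], for which [K <= 54/100] is
   enough. *)
have Av : 28 <= A * v by nra.
have n0 : 0 < n%:R :> R by rewrite ltr0n; exact: leq_trans hn.
have K0 : 0 <= K by rewrite /K /exceedance !mulr_ge0// ?invr_ge0 ?normal_pdf_ge0// ltW.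
have pi0 := pi_gt0 R.
have peak : normal_pdf 0 1 a ^+ 2 = expR (- A) / (2 * pi).
  rewrite normal_pdfE ?oner_eq0// exprMn /normal_peak /normal_fun exprVn sqr_sqrtr.
    rewrite -expRM_natl mulrC; congr (expR _ / _); last by rewrite expr1n; ring.
    by rewrite subr0 expr1n aE; field.
  by rewrite mulrn_wge0// mulr_ge0// ?sqr_ge0// ltW.
have expA : expR (- A) = 2 * L / (2 * n%:R) ^+ 2.
  have -> : - A = ln (2 * L) + - (2%:R * L) by rewrite /A; ring.
  rewrite expRD expRN expRM_natl !lnK ?posrE ?mulr_gt0//; lra.
have K2 : K ^+ 2 * (pi * A) = L.
  have -> : K ^+ 2 = 4 * n%:R ^+ 2 * normal_pdf 0 1 a ^+ 2 / a ^+ 2.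
    by rewrite /K /exceedance; field; rewrite gt_eqF.
  rewrite peak expA aE; have := gt_eqF pi0; move: (pi : R) => q q0.
  by field; rewrite (gt_eqF A0) (gt_eqF n0) q0.
(* The crude bounds [2 <= pi <= 4] and [7/4 L <= A <= 2 L] confine [K^2] to [[1/8, 2/7]]. *)
have pi2 := pi_ge2 R; have pi4 := pihalf_lt2 R.
have piA1 : 7 / 2 * L <= pi * A by nra.
have piA2 : pi * A <= 8 * L by nra.
have K1 : 1 / 8 <= K ^+ 2.
  rewrite leNgt; apply/negP => K8.
  have : K ^+ 2 * (pi * A) <= K ^+ 2 * (8 * L) by rewrite ler_wpM2l ?sqr_ge0.
  have L0 : 0 < L by lra.
  by move: K8; rewrite -(ltr_pM2r L0) K2; lra.
have K3 : K ^+ 2 <= 2 / 7.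
  rewrite leNgt; apply/negP => K8.
  have : K ^+ 2 * (7 / 2 * L) <= K ^+ 2 * (pi * A) by rewrite ler_wpM2l ?sqr_ge0.
  have L0 : 0 < L by lra.
  by move: K8; rewrite -(ltr_pM2r L0) K2; lra.
have K4 : 7 / 20 <= K by rewrite leNgt; apply/negP => ?; nra.
have K5 : K <= 54 / 100 by rewrite leNgt; apply/negP => ?; nra.
by rewrite aE; split => //; lra.
Qed.

(** * Chernoff's bound and the conclusion *)

(** With [x = s l], this [l] minimises [x^2/(2(1 - x)) - x (u^2/2 + u)]: stationarity reads
    [(1 - x)^(-2) = (1 + u)^2]. *)
Lemma chernoff_exponent (R : realType) (s u : R) (l := u / (1 + u) / s) :
  0 < s -> 0 < u ->
  s ^+ 2 * l ^+ 2 / (2 * (1 - s * l)) - l * (s * (u ^+ 2 / 2 + u)) = - (u ^+ 2 / 2).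
Proof.
move=> s0 u0; have u1 : 0 < 1 + u by lra.
have -> : 1 - s * l = (1 + u)^-1 by rewrite /l; field; rewrite (gt_eqF s0) (gt_eqF u1).
by rewrite /l; field; rewrite (gt_eqF s0) (gt_eqF u1).
Qed.

Unset Implicit Arguments.

Theorem proposition4p5 (R : realType) (d : measure_display)
  (T : measurableType d) (P : probability T R)
  (n : nat) (hn : (2 <= n)%N)
  (v : R) (hv0 : 0 < v)
  (hv : 16 / v + ln (1 + 2 / v + 4 * ln (4 / v)) = ln (2 * n%:R))
  (hv1 : v < 1)
  (X : 'I_n -> {RV P >-> R})
  (hX : forall i, standard_gaussian P (X i))
  (hind : mutually_independent P X) :
  (forall lambda : R, 0 <= lambda -> lambda < 1 / Num.sqrt v ->
    (lne 'E_P[fun w => expR (lambda * (max_abs X w - fine 'E_P[max_abs X]))]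
     <= (v * lambda ^+ 2 / (2 * (1 - Num.sqrt v * lambda)))%:E)%E) /\
  (forall t : R, 0 < t ->
    (P [set w | max_abs X w - fine 'E_P[max_abs X]
                > Num.sqrt v * (t + Num.sqrt (2 * t))]%R
     <= (expR (- t))%:E)%E).
Proof.
have [a [a0 K1 av4 Kav]] := exists_threshold hn hv0 hv hv1.
set K := exceedance n a in K1 Kav.
pose s := Num.sqrt v; rewrite -/s.
have s0 : 0 < s by rewrite sqrtr_gt0.
have sE : s ^+ 2 = v by rewrite sqr_sqrtr// ltW.
have mgf l : 0 <= l -> l < 1 / s ->
    ('E_P[fun w => expR (l * (max_abs X w - fine 'E_P[max_abs X]))] <=
     (expR (v * l ^+ 2 / (2 * (1 - s * l))))%:E)%E.
  move=> l0 ls; have sl1 : s * l < 1 by rewrite mulrC -ltr_pdivlMr.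
  (* This combines [s l < 1] with [a s >= 2], which comes from [a^2 v >= 4]. *)
  have la : l <= a / 2.
    rewrite -(ler_pM2l s0); apply: le_trans (ltW sl1) _.
    have : 2 <= a * s.
      rewrite -(@ler_pXn2r _ 2)// ?nnegrE ?mulr_ge0 ?(ltW a0) ?(ltW s0)//.
      by rewrite exprMn sE; lra.
    by lra.
  apply: le_trans (max_abs_mgf_le hX hind a0 K1 l0 la) _; rewrite lee_fin ler_expR -/K.
  (* The estimate reached is sub-Gaussian; dividing by [1 - s l], which lies in []0, 1]], only
     enlarges it. *)
  apply: (@le_trans _ _ (v * l ^+ 2 / 2)).
    have -> : (l / a) ^+ 2 * (4 * K + 100 / 9) = l ^+ 2 / a ^+ 2 * (4 * K + 100 / 9).
      by rewrite expr_div_n.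
    rewrite mulrAC ler_pdivrMr ?exprn_gt0//.
    have := ler_wpM2l (sqr_ge0 l) Kav; lra.
  have sl0 : 0 <= s * l by rewrite mulr_ge0// ltW.
  rewrite ler_pdivlMr ?mulr_gt0 ?subr_gt0//.
  have := mulr_ge0 (mulr_ge0 (ltW hv0) (sqr_ge0 l)) sl0; lra.
split=> [l l0 ls|t t0].
  rewrite -[leRHS]expeRK lee_lne; first exact: mgf.
    by rewrite in_itv/= leey andbT; apply: expectation_ge0 => w; exact: expR_ge0.
  by rewrite in_itv/= leey andbT lee_fin expR_ge0.
pose u := Num.sqrt (2 * t).
have u0 : 0 < u by rewrite sqrtr_gt0 mulr_gt0.
have uE : t = u ^+ 2 / 2 by rewrite sqr_sqrtr ?mulr_ge0 ?ltW//; field.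
pose l := u / (1 + u) / s.
have u1 : 0 < 1 + u by lra.
have l0 : 0 < l by rewrite !divr_gt0.
have ls : l < 1 / s by rewrite ltr_pM2r ?invr_gt0// ltr_pdivrMr//; lra.
have mY : measurable_fun [set: T] (fun w => max_abs X w - fine 'E_P[max_abs X]).
  by apply: measurable_funB => //; exact: measurable_max_abs.
pose Y : {RV P >-> R} := mfun_Sub (mem_set mY).
(* Chernoff's inequality concerns the non-strict event, which contains the strict one. *)
apply: (@le_trans _ _ (P [set w | Y w >= s * (t + u)])).
  apply: le_measure; rewrite ?inE.
  - rewrite -[X in measurable X]setTI.
    by have := mY measurableT _ (measurable_itv `]s * (t + u), +oo[); rewrite set_itvoy.
  - rewrite -[X in measurable X]setTI.
    by have := mY measurableT _ (measurable_itv `[s * (t + u), +oo[); rewrite set_itvcy.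
  - by move=> w /= /ltW.
apply: le_trans (chernoff Y _ l0) _.
have -> : ('M_P Y l = 'E_P[fun w => expR (l * (max_abs X w - fine 'E_P[max_abs X]))])%E.
  rewrite /mmt_gen_fun; congr expectation; apply/funext => w /=.
  by rewrite mulrC.
apply: le_trans (lee_wpmul2r _ (mgf l (ltW l0) ls)) _; first by rewrite lee_fin expR_ge0.
rewrite -EFinM -expRD lee_fin ler_expR.
by rewrite -sE uE [leLHS](chernoff_exponent s0 u0).
Qed.
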